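(* Let $R$ be a Noetherian ring and $M$ a (finitely generated) pretty clean $R$-module. Then all pretty clean filtrations of $M$ have the same length, namely their common length equals $\sum_{\mathfrak p\in\operatorname{Ass}(M)}\operatorname{mult}_M(\mathfrak p)$.
   Context: A pretty clean filtration of a finitely generated $R$-module $M$ is a filtration $0=M_0\subset M_1\subset\cdots\subset M_r=M$ by submodules with $M_i/M_{i-1}\cong R/P_i$, $P_i$ a prime ideal, for $i=1,\dots,r$, such that for all $i<j$ with $P_i\subset P_j$ one has $P_i=P_j$; its length is $r$. $M$ is pretty clean if it has such a filtration. For $\mathfrak p\in\operatorname{Spec}(R)$, $\operatorname{mult}_M(\mathfrak p)=\ell(H^0_{\mathfrak p}(M_{\mathfrak p}))$, the length over $R_{\mathfrak p}$ of the submodule of $M_{\mathfrak p}$ of elements annihilated by some power of $\mathfrak pR_{\mathfrak p}$. *)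

(* Defs.v *)
From HB Require Import structures.
From mathcomp Require Import all_boot all_order all_algebra generic_quotient.
From mathcomp Require Import boolp classical_sets functions cardinality fsbigop.
From mathcomp Require Import constructive_ereal ereal.
From mathcomp Require Import ring.

Set Implicit Arguments.
Unset Strict Implicit.
Unset Printing Implicit Defensive.

Import GRing.Theory.

Local Open Scope classical_set_scope.
Local Open Scope ring_scope.
Local Open Scope quotient_scope.

(* Submodules of [M] are the bundled predicates [N : submodClosed M], and     *)
(* ideals of [R] are the submodules of [R^o].  These predicates are boolean,  *)
(* but since boolp is available every [Prop]-valued submodule has this form.  *)

Section SubmodType.
Variables (R : pzRingType) (M : lmodType R) (N : submodClosed M).

Record submod_type := SubmodType { submod_val :> M; _ : submod_val \in N }.

HB.instance Definition _ := [isSub for submod_val].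
HB.instance Definition _ := [Choice of submod_type by <:].
HB.instance Definition _ :=
  GRing.SubChoice_isSubLmodule.Build R M (fun x => x \in N) submod_type
    (GRing.subsemimodClosedP N).

(* A submodule [L] of [M], restricted to a submodule of [N]. *)
Definition restrict_submod_pred (L : submodClosed M) : {pred submod_type} :=
  fun x => submod_val x \in L.

Fact restrict_submod_closed L : subsemimod_closed (restrict_submod_pred L).
Proof.
have [[L0 LD] LZ] := GRing.subsemimodClosedP L.
split=> [|a x xL]; last exact: LZ.
by split=> [|x y xL yL]; [exact: L0|exact: LD].
Qed.

HB.instance Definition _ L :=
  GRing.isSubmodClosed.Build R submod_type (restrict_submod_pred L)
    (restrict_submod_closed L).

Definition restrict_submod (L : submodClosed M) : submodClosed submod_type :=
  restrict_submod_pred L.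

End SubmodType.

Section QuotMod.
Variables (R : pzRingType) (M : lmodType R) (N : submodClosed M).

Definition submod_pred : {pred M} := fun x => x \in N.

Fact submod_zmod_closed : zmod_closed submod_pred.
Proof. exact: GRing.submod_closedB (submodClosedP N). Qed.

HB.instance Definition _ :=
  GRing.isZmodClosed.Build M submod_pred submod_zmod_closed.

Definition quot_mod := @Quotient.quot M submod_pred.

HB.instance Definition _ := GRing.Zmodule.on quot_mod.
HB.instance Definition _ := EqQuotient.on quot_mod.

Definition quot_pi (x : M) : quot_mod := \pi_quot_mod x.

Lemma quot_piP (x : quot_mod) : exists y, x = quot_pi y.
Proof. by exists (repr x); rewrite /quot_pi reprK. Qed.

Lemma quot_piE (x y : M) : (quot_pi x = quot_pi y) <-> (x - y \in N).
Proof.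
have -> : (x - y \in N) = (quot_pi x == quot_pi y).
  by rewrite -[LHS]/(x - y \in submod_pred) Quotient.idealrBE.
by split=> [/eqP|/eqP].
Qed.

Lemma quot_piD (x y : M) : quot_pi (x + y) = quot_pi x + quot_pi y.
Proof. exact: (@Quotient.pi_add M submod_pred). Qed.

Definition quot_scale (a : R) (x : quot_mod) : quot_mod :=
  quot_pi (a *: repr x).

Lemma quot_piZ a x : quot_scale a (quot_pi x) = quot_pi (a *: x).
Proof.
apply/quot_piE; rewrite -scalerBr; apply: rpredZ.
by apply/quot_piE; rewrite /quot_pi reprK.
Qed.

Fact quot_scaleA a b x :
  quot_scale a (quot_scale b x) = quot_scale (a * b) x.
Proof. by have [y ->] := quot_piP x; rewrite !quot_piZ scalerA. Qed.

Fact quot_scale1 : left_id 1 quot_scale.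
Proof. by move=> x; have [y ->] := quot_piP x; rewrite quot_piZ scale1r. Qed.

Fact quot_scaleDr : right_distributive quot_scale +%R.
Proof.
move=> a x y; have [[x' ->] [y' ->]] := (quot_piP x, quot_piP y).
by rewrite -quot_piD !quot_piZ -quot_piD scalerDr.
Qed.

Fact quot_scaleDl x : {morph quot_scale^~ x : a b / a + b}.
Proof.
by move=> a b; have [y ->] := quot_piP x; rewrite !quot_piZ -quot_piD scalerDl.
Qed.

HB.instance Definition _ :=
  GRing.Zmodule_isLmodule.Build R quot_mod
    quot_scaleA quot_scale1 quot_scaleDr quot_scaleDl.

End QuotMod.

Section Modules.
Variable R : pzRingType.
Implicit Types M : lmodType R.

Definition isomorphic (M1 M2 : lmodType R) : Prop :=
  exists f : {linear M1 -> M2}, bijective f.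

(* The subquotient [N / L], for submodules [L] and [N] of [M]; in practice    *)
(* [L] is contained in [N].                                                   *)
Definition subquotient M (N L : submodClosed M) : lmodType R :=
  quot_mod (restrict_submod N L).

Definition finitely_generated M : Prop :=
  exists (n : nat) (g : 'I_n -> M),
    forall x, exists c : 'I_n -> R, x = \sum_(i < n) c i *: g i.

Definition submod_chain M (n : nat) (C : nat -> submodClosed M) : Prop :=
  forall i, (i < n)%N ->
    {subset C i <= C i.+1} /\ ~ {subset C i.+1 <= C i}.

(* The length of a module, with values in the extended integers: the supremum *)
(* of the lengths of its strictly increasing chains of submodules.            *)
Definition module_length M : \bar int :=
  supremum -oo%E [set n%:Z%:E | n in [set n | exists C, @submod_chain M n C]].

End Modules.

Section Ideals.
Variable R : comPzRingType.
Implicit Types M : lmodType R.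

Definition noetherian_ring : Prop :=
  forall I : submodClosed R^o, finitely_generated (submod_type I).

(* [spec_fun] is a bare boolean function rather than a [submodClosed R^o] or  *)
(* a [{pred R}], since the universes of these are too large to form           *)
(* [set Spec].                                                                *)
Record Spec := MkSpec {
  spec_fun : R -> bool;
  spec_ideal : submod_closed (spec_fun : {pred R^o});
  spec_proper : 1 \notin (spec_fun : {pred R});
  spec_prime : forall a b, a * b \in (spec_fun : {pred R}) ->
    a \in (spec_fun : {pred R}) \/ b \in (spec_fun : {pred R})
}.

Definition spec_pred (p : Spec) : {pred R} := spec_fun p.
Coercion spec_pred : Spec >-> pred_sort.

Lemma Spec_ext (p q : Spec) : p =i q -> p = q.
Proof.
case: p q => [p p1 p2 p3] [q q1 q2 q3] /= pq.
have {pq} epq : p = q by apply/funext => x; have := pq x.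
by case: q / epq q1 q2 q3 => q1 q2 q3; congr MkSpec; exact: Prop_irrelevance.
Qed.

HB.instance Definition _ := gen_eqMixin Spec.
HB.instance Definition _ := gen_choiceMixin Spec.

Definition spec_submod_pred (p : Spec) : {pred R^o} := spec_fun p.

Fact spec_subsemimod_closed p : subsemimod_closed (spec_submod_pred p).
Proof. exact: GRing.submod_closed_semi (spec_ideal p). Qed.

HB.instance Definition _ p :=
  GRing.isSubmodClosed.Build R R^o (spec_submod_pred p)
    (spec_subsemimod_closed p).

(* The ideal [p], as a submodule of [R^o]. *)
Definition spec_submod (p : Spec) : submodClosed R^o := spec_submod_pred p.

(* Ass(M): the primes that are the annihilator of an element of [M]. *)
Definition Ass M : set Spec :=
  [set p : Spec | exists x : M, forall a : R, a \in p <-> a *: x = 0].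

Definition ideal_mul (I J : set R) : set R :=
  [set x | exists s : seq (R * R),
     (forall z, z \in s -> I z.1 /\ J z.2) /\ x = \sum_(z <- s) z.1 * z.2].

Definition ideal_pow (I : set R) (n : nat) : set R :=
  iter n (ideal_mul I) setT.

Lemma ideal_powM (I : set R) n a b : ideal_pow I n b -> ideal_pow I n (a * b).
Proof.
elim: n => [//|n IHn] in b * => -[s [sP ->]].
exists [seq (z.1, a * z.2) | z <- s]; split.
  by move=> _ /mapP[z /sP[Iz Jz] ->]; split=> //=; exact: IHn.
by rewrite big_map mulr_sumr; apply: eq_bigr => z _ /=; rewrite mulrCA.
Qed.

Lemma ideal_powD (I : set R) n a b :
  ideal_pow I n a -> ideal_pow I n b -> ideal_pow I n (a + b).
Proof.
case: n => [//|n] [s [sP ->]] [t [tP ->]].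
exists (s ++ t); rewrite big_cat; split=> // z.
by rewrite mem_cat => /orP[/sP|/tP].
Qed.

Lemma ideal_pow0 (I : set R) n : ideal_pow I n 0.
Proof. by case: n => [//|n]; exists [::]; rewrite big_nil. Qed.

Lemma ideal_powS (I : set R) n : ideal_pow I n.+1 `<=` ideal_pow I n.
Proof.
move=> _ [s [sP ->]]; elim: s sP => [|z s IHs] sP.
  by rewrite big_nil; exact: ideal_pow0.
rewrite big_cons; apply: ideal_powD.
  by apply: ideal_powM; have [] := sP z (mem_head _ _).
by apply: IHs => y ys; apply: sP; rewrite inE ys orbT.
Qed.

Lemma ideal_pow_le (I : set R) n m : (n <= m)%N ->
  ideal_pow I m `<=` ideal_pow I n.
Proof.
move=> /subnK <-; elim: (m - n)%N => [//|k IHk] a; rewrite addSn.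
by move=> /ideal_powS; exact: IHk.
Qed.

(* [H^0_I(M)]: the elements of [M] annihilated by some power of [I]. *)
Definition local_cohomology0_pred (I : set R) M : {pred M} :=
  fun x => `[< exists n, forall a, ideal_pow I n a -> a *: x = 0 >].

Fact local_cohomology0_closed I M :
  subsemimod_closed (@local_cohomology0_pred I M).
Proof.
split; [split|].
- by apply/asboolP; exists 0%N => a _; rewrite scaler0.
- move=> x y /asboolP[n nP] /asboolP[m mP]; apply/asboolP.
  exists (maxn n m) => a anm; rewrite scalerDr nP ?mP ?addr0//.
    by apply: ideal_pow_le anm; rewrite leq_maxr.
  by apply: ideal_pow_le anm; rewrite leq_maxl.
- move=> b x /asboolP[n nP]; apply/asboolP; exists n => a an.
  by rewrite scalerA mulrC -scalerA nP// scaler0.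
Qed.

HB.instance Definition _ I M :=
  GRing.isSubmodClosed.Build R M (@local_cohomology0_pred I M)
    (local_cohomology0_closed I M).

Definition local_cohomology0 (I : set R) M : submodClosed M :=
  @local_cohomology0_pred I M.

End Ideals.

Section ScaleIdentities.
Variables (R : comPzRingType) (M : lmodType R).
Implicit Types (a b s t u v w : R) (k m n : M).

Fact scale_eq_trans u v s t w m n k :
    u *: (t *: m) = u *: (s *: n) -> v *: (w *: n) = v *: (t *: k) ->
  (u * v * t) *: (w *: m) = (u * v * t) *: (s *: k).
Proof.
move=> uP vP; transitivity ((v * w) *: (u *: (t *: m))).
  by rewrite !scalerA; congr (_ *: _); ring.
rewrite uP; transitivity ((u * s) *: (v *: (w *: n))).
  by rewrite !scalerA; congr (_ *: _); ring.
by rewrite vP !scalerA; congr (_ *: _); ring.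
Qed.

Fact scale_eq_add u v s t s' t' m n m' n' :
    u *: (s' *: m) = u *: (s *: m') -> v *: (t' *: n) = v *: (t *: n') ->
  (u * v) *: ((s' * t') *: (t *: m + s *: n)) =
  (u * v) *: ((s * t) *: (t' *: m' + s' *: n')).
Proof.
move=> uP vP; rewrite !scalerDr; congr (_ + _).
  transitivity ((v * t * t') *: (u *: (s' *: m))).
    by rewrite !scalerA; congr (_ *: _); ring.
  by rewrite uP !scalerA; congr (_ *: _); ring.
transitivity ((u * s * s') *: (v *: (t' *: n))).
  by rewrite !scalerA; congr (_ *: _); ring.
by rewrite vP !scalerA; congr (_ *: _); ring.
Qed.

Fact scale_eq_scale u v s t s' t' a a' m m' :
    u * (s' * a) = u * (s * a') -> v *: (t' *: m) = v *: (t *: m') ->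
  (u * v) *: ((s' * t') *: (a *: m)) = (u * v) *: ((s * t) *: (a' *: m')).
Proof.
move=> uP vP; transitivity ((u * (s' * a)) *: (v *: (t' *: m))).
  by rewrite !scalerA; congr (_ *: _); ring.
by rewrite uP vP !scalerA; congr (_ *: _); ring.
Qed.

(* In the next three statements, the cross-multiplied forms of the laws for   *)
(* fractions are given in [R] rather than in [R^o], as needed by [ring].      *)
Fact scale_eqA s t w a b m :
  (1 : R) *: ((s * t * w) *: (a *: (b *: m))) =
  (1 : R) *: ((s * (t * w)) *: ((a * b) *: m)).
Proof. by rewrite !scalerA; congr (_ *: _); ring. Qed.

Fact scale_eqDl s t w a b m :
  (1 : R) *: ((s * w * (t * w)) *: ((t * a + s * b) *: m)) =
  (1 : R) *: ((s * t * w) *: ((t * w) *: (a *: m) + (s * w) *: (b *: m))).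
Proof. by rewrite !scalerDr !scalerA -scalerDl; congr (_ *: _); ring. Qed.

Fact mul_eqC (s t a b : R) : 1 * ((t * s) * (a * b)) = 1 * ((s * t) * (b * a)).
Proof. by ring. Qed.

End ScaleIdentities.

Section Localization.
Variables (R : comPzRingType) (p : Spec R).

(* The denominators: the elements of the complement of [p]. *)
Record loc_denom := LocDenom { loc_denom_val :> R; _ : loc_denom_val \notin p }.

HB.instance Definition _ := [isSub for loc_denom_val].
HB.instance Definition _ := [Choice of loc_denom by <:].

Fact loc_denom1_subproof : 1 \notin p. Proof. exact: spec_proper. Qed.
Definition loc_denom1 : loc_denom := LocDenom loc_denom1_subproof.

Fact loc_denomM_subproof (s t : loc_denom) : (s : R) * (t : R) \notin p.
Proof.
by case: s t => [s sp] [t tp] /=; apply/negP => /spec_prime[]; apply/negP.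
Qed.
Definition loc_denomM (s t : loc_denom) : loc_denom := LocDenom (loc_denomM_subproof s t).

Section LocMod.
Variable M : lmodType R.
Implicit Types (m n : M) (s t : loc_denom).

Definition loc_equiv : rel (M * loc_denom) := fun x y =>
  `[< exists u : loc_denom,
        (u : R) *: ((y.2 : R) *: x.1) = (u : R) *: ((x.2 : R) *: y.1) >].

Fact loc_equiv_class : equiv_class_of loc_equiv.
Proof.
split=> [[m s]|[m s] [n t]|[n t] [m s] [k w]]; rewrite /loc_equiv /=.
- by apply/asboolP; exists loc_denom1.
- by apply/asboolP/asboolP => -[u uP]; exists u.
- move=> /asboolP[/= u uP] /asboolP[/= v vP]; apply/asboolP => /=.
  by exists (loc_denomM (loc_denomM u v) t); exact: scale_eq_trans uP vP.
Qed.

Canonical loc_equiv_equiv := EquivRelPack loc_equiv_class.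
Canonical loc_equiv_encModRel := defaultEncModRel loc_equiv.

(* The localization [M_p]. *)
Definition loc_mod := {eq_quot loc_equiv}.

HB.instance Definition _ := Choice.on loc_mod.
HB.instance Definition _ := EqQuotient.on loc_mod.

(* The fraction [m / s]. *)
Definition loc_frac m s : loc_mod := \pi_loc_mod (m, s).

Lemma loc_fracE m n s t :
  loc_frac m s = loc_frac n t <->
  exists u : loc_denom, (u : R) *: ((t : R) *: m) = (u : R) *: ((s : R) *: n).
Proof.
split=> [/eqP|mn]; last apply/eqP; rewrite /loc_frac piE; last exact/asboolP.
by move=> /asboolP.
Qed.

Lemma loc_fracP (x : loc_mod) : exists m s, x = loc_frac m s.
Proof.
by exists (repr x).1, (repr x).2; rewrite /loc_frac -surjective_pairing reprK.
Qed.

Lemma loc_frac_repr m s :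
  exists u : loc_denom, (u : R) *: (((repr (loc_frac m s)).2 : R) *: m) =
    (u : R) *: ((s : R) *: (repr (loc_frac m s)).1).
Proof. by apply/loc_fracE; rewrite [RHS]/loc_frac -surjective_pairing reprK. Qed.

Definition loc_zero : loc_mod := loc_frac 0 loc_denom1.

Definition loc_opp (x : loc_mod) : loc_mod := loc_frac (- (repr x).1) (repr x).2.

Definition loc_add (x y : loc_mod) : loc_mod :=
  loc_frac (((repr y).2 : R) *: (repr x).1 + ((repr x).2 : R) *: (repr y).1)
       (loc_denomM (repr x).2 (repr y).2).

Lemma loc_frac_oppE m s : loc_opp (loc_frac m s) = loc_frac (- m) s.
Proof.
by have [u uP] := loc_frac_repr m s; apply/loc_fracE; exists u; rewrite !scalerN uP.
Qed.

Lemma loc_frac_addE m n s t :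
  loc_add (loc_frac m s) (loc_frac n t) =
  loc_frac ((t : R) *: m + (s : R) *: n) (loc_denomM s t).
Proof.
have [[u uP] [v vP]] := (loc_frac_repr m s, loc_frac_repr n t).
apply/esym/loc_fracE; exists (loc_denomM u v); exact: scale_eq_add uP vP.
Qed.

Fact loc_addA : associative loc_add.
Proof.
move=> x y z; have [m [s ->]] := loc_fracP x; have [n [t ->]] := loc_fracP y.
have [k [w ->]] := loc_fracP z; rewrite !loc_frac_addE; apply/loc_fracE.
exists loc_denom1; rewrite /= !scalerDr !scalerA -addrA.
by congr (_ *: _ + (_ *: _ + _ *: _)); ring.
Qed.

Fact loc_addC : commutative loc_add.
Proof.
move=> x y; have [m [s ->]] := loc_fracP x; have [n [t ->]] := loc_fracP y.
rewrite !loc_frac_addE; apply/loc_fracE.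
exists loc_denom1; rewrite /= !scalerDr !scalerA addrC.
by congr (_ *: _ + _ *: _); ring.
Qed.

Fact loc_add0 : left_id loc_zero loc_add.
Proof.
move=> x; have [m [s ->]] := loc_fracP x; rewrite loc_frac_addE; apply/loc_fracE.
by exists loc_denom1; rewrite /= scaler0 add0r !scalerA; congr (_ *: _); ring.
Qed.

Fact loc_addN : left_inverse loc_zero loc_opp loc_add.
Proof.
move=> x; have [m [s ->]] := loc_fracP x; rewrite loc_frac_oppE loc_frac_addE; apply/loc_fracE.
by exists loc_denom1; rewrite /= scalerN addNr !scaler0.
Qed.

HB.instance Definition _ :=
  GRing.isZmodule.Build loc_mod loc_addA loc_addC loc_add0 loc_addN.

Lemma loc_fracD m n s t :
  loc_frac m s + loc_frac n t =
  loc_frac ((t : R) *: m + (s : R) *: n) (loc_denomM s t).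
Proof. exact: loc_frac_addE. Qed.

End LocMod.

(* The localization [R_p]. *)
Definition loc_ring := loc_mod R^o.

HB.instance Definition _ := GRing.Zmodule.on loc_ring.

Definition loc_rfrac (a : R) (s : loc_denom) : loc_ring := loc_frac (a : R^o) s.

Lemma loc_rfracP (x : loc_ring) : exists a s, x = loc_rfrac a s.
Proof. by have [a [s ->]] := loc_fracP x; exists a, s. Qed.

Section LocScale.
Variable M : lmodType R.

Definition loc_scale (x : loc_ring) (y : loc_mod M) : loc_mod M :=
  loc_frac (((repr x).1 : R) *: (repr y).1) (loc_denomM (repr x).2 (repr y).2).

Lemma loc_frac_scaleE a s (m : M) t :
  loc_scale (loc_rfrac a s) (loc_frac m t) = loc_frac (a *: m) (loc_denomM s t).
Proof.
have [[u uP] [v vP]] := (loc_frac_repr (a : R^o) s, loc_frac_repr m t).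
apply/esym/loc_fracE; exists (loc_denomM u v); exact: scale_eq_scale uP vP.
Qed.

End LocScale.

Definition loc_one : loc_ring := loc_rfrac 1 loc_denom1.

Definition loc_mul : loc_ring -> loc_ring -> loc_ring := @loc_scale R^o.

Section LocScaleTheory.
Variable M : lmodType R.
Implicit Types (x y : loc_ring) (z : loc_mod M).

Fact loc_scaleA x y z : loc_scale x (loc_scale y z) = loc_scale (loc_mul x y) z.
Proof.
have [a [s ->]] := loc_rfracP x; have [b [t ->]] := loc_rfracP y.
have [m [w ->]] := loc_fracP z; rewrite (loc_frac_scaleE b t m w) (loc_frac_scaleE a s).
rewrite /loc_mul (loc_frac_scaleE a s (b : R^o) t) (loc_frac_scaleE (a * b)).
apply/loc_fracE; exists loc_denom1; exact: scale_eqA.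
Qed.

Fact loc_scale1 : left_id loc_one (@loc_scale M).
Proof.
move=> z; have [m [s ->]] := loc_fracP z; rewrite loc_frac_scaleE.
by apply/loc_fracE; exists loc_denom1; rewrite /= !scalerA; congr (_ *: _); ring.
Qed.

Fact loc_scaleDr : right_distributive (@loc_scale M) +%R.
Proof.
move=> x y z; have [a [s ->]] := loc_rfracP x; have [m [t ->]] := loc_fracP y.
have [n [w ->]] := loc_fracP z; rewrite loc_fracD !loc_frac_scaleE loc_fracD; apply/loc_fracE.
exists loc_denom1; rewrite /= !scalerDr !scalerA.
by congr (_ *: _ + _ *: _); ring.
Qed.

Fact loc_scaleDl z : {morph (@loc_scale M)^~ z : x y / x + y}.
Proof.
move=> x y; have [a [s ->]] := loc_rfracP x; have [b [t ->]] := loc_rfracP y.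
have [m [w ->]] := loc_fracP z.
rewrite [loc_rfrac a s + _]loc_fracD (loc_frac_scaleE ((t : R) * a + (s : R) * b)).
rewrite (loc_frac_scaleE a s) (loc_frac_scaleE b t) loc_fracD; apply/loc_fracE.
exists loc_denom1; exact: scale_eqDl.
Qed.

End LocScaleTheory.

Fact loc_mulA : associative loc_mul.
Proof. exact: loc_scaleA. Qed.

Fact loc_mulC : commutative loc_mul.
Proof.
move=> x y; have [a [s ->]] := loc_rfracP x; have [b [t ->]] := loc_rfracP y.
rewrite /loc_mul !loc_frac_scaleE; apply/loc_fracE; exists loc_denom1.
exact: mul_eqC.
Qed.

Fact loc_mul1 : left_id loc_one loc_mul.
Proof. exact: loc_scale1. Qed.

Fact loc_mulDl : left_distributive loc_mul +%R.
Proof. by move=> x y z; exact: loc_scaleDl. Qed.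

HB.instance Definition _ :=
  GRing.Zmodule_isComPzRing.Build loc_ring
    loc_mulA loc_mulC loc_mul1 loc_mulDl.

HB.instance Definition _ (M : lmodType R) :=
  GRing.Zmodule_isLmodule.Build loc_ring (loc_mod M)
    (@loc_scaleA M) (@loc_scale1 M) (@loc_scaleDr M) (@loc_scaleDl M).

(* The maximal ideal [p R_p]. *)
Definition loc_max : set loc_ring :=
  [set x | exists a s, a \in p /\ x = loc_rfrac a s].

Definition mult (M : lmodType R) : \bar int :=
  module_length
    (submod_type (local_cohomology0 loc_max (loc_mod M : lmodType loc_ring))).

End Localization.

Section PrettyClean.
Variables (R : comPzRingType) (M : lmodType R).

(* [F 0, ..., F r] are the submodules M_0, ..., M_r, and [P i] is the prime   *)
(* of the factor M_{i+1} / M_i; values at larger indices are irrelevant.      *)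
Definition pretty_clean_filtration (r : nat) (F : nat -> submodClosed M) :=
  [/\ F 0%N =i pred1 0,
      F r =i predT,
      forall i, (i < r)%N -> {subset F i <= F i.+1} &
      exists P : nat -> Spec R,
        (forall i, (i < r)%N ->
           isomorphic (subquotient (F i.+1) (F i))
                      (quot_mod (spec_submod (P i))))
        /\ (forall i j, (i < j < r)%N -> {subset P i <= P j} -> P i = P j)].

Definition pretty_clean : Prop :=
  exists r F, pretty_clean_filtration r F.

End PrettyClean.

(* Main.v *)
(** Fix a pretty clean filtration with primes P_i and a prime p, and let H be
    H^0_p(M_p).  Localizing at p kills the factors with P_i not contained in p;
    a factor with P_i strictly contained in p becomes a domain with no p-power
    torsion, so it does not meet H; a factor with P_i = p becomes the simple
    module R_p / p R_p.  Hence a submodule L of H is determined among its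
    submodules by the set of indices i with P_i = p at which L jumps, and every
    chain in H has length at most k = #{i | P_i = p}.

    Pretty cleanness makes the bound sharp: if P_i = p, no earlier P_j is
    strictly contained in p, so the localization of M_{i+1} is killed by a power
    of p R_p and lies in H; the first factor equal to R/p, multiplied by an
    element outside p killing everything below it, also shows p in Ass(M).
    Since Ass(M) is thus exactly {P_i}, summing the counts k over Ass(M)
    gives r. *)

From HB Require Import structures.
Require Import Defs.
From mathcomp Require Import all_boot all_order all_algebra.
From mathcomp Require Import boolp classical_sets functions cardinality fsbigop.
From mathcomp Require Import constructive_ereal ereal.

Set Implicit Arguments.
Unset Strict Implicit.
Unset Printing Implicit Defensive.

Import GRing.Theory.

Local Open Scope classical_set_scope.
Local Open Scope ring_scope.

(** * Submodules and cyclic subquotients *)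

Lemma submodB (R : pzRingType) (M : lmodType R) (N : submodClosed M) x y :
  x \in N -> y \in N -> x - y \in N.
Proof. by move=> xN yN; rewrite -scaleN1r rpredD ?rpredZ. Qed.

Lemma submod_valD (R : pzRingType) (M : lmodType R) (N : submodClosed M) :
  {morph @submod_val R M N : x y / x + y}.
Proof. by []. Qed.

Lemma submod_valZ (R : pzRingType) (M : lmodType R) (N : submodClosed M) a :
  {morph @submod_val R M N : x / a *: x}.
Proof. by []. Qed.

(** The class of 1 lifts to a generator [g] of [N] modulo [L]. Through it the factors of the
    filtration are handled by elements alone. *)
Lemma isomorphic_cyclic (R : comPzRingType) (M : lmodType R)
    (N L : submodClosed M) (p : Spec R) :
    isomorphic (subquotient N L) (quot_mod (spec_submod p)) ->
  exists2 g, g \in N &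
    (forall a, a *: g \in L <-> a \in p) /\
    (forall x, x \in N -> exists a, x - a *: g \in L).
Proof.
move=> [f [f' fK f'K]].
have [[g gN] fg] := quot_piP (f' (quot_pi (spec_submod p) (1 : R^o))).
have fgE (a : R) : f (quot_pi _ (a *: SubmodType gN)) =
    quot_pi (spec_submod p) (a : R^o).
  have -> : quot_pi (restrict_submod N L) (a *: SubmodType gN) =
      a *: quot_pi _ (SubmodType gN) by rewrite -quot_piZ.
  rewrite linearZ -fg f'K.
  by rewrite -[LHS]/(quot_scale _ _) quot_piZ; congr quot_pi; exact: mulr1.
exists g => //; split=> [a|x xN].
  have inL : a *: g \in L <->
      quot_pi (restrict_submod N L) (a *: SubmodType gN) = quot_pi _ 0.
    by rewrite quot_piE subr0.
  have inp : a \in p <->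
      quot_pi (spec_submod p) (a : R^o) = quot_pi _ (0 : R^o).
    by rewrite quot_piE subr0.
  rewrite inL inp -!fgE scale0r; split=> [->//|]; exact: (can_inj fK).
have [a fa] := quot_piP (f (quot_pi _ (SubmodType xN))).
exists a; move: fa; rewrite -fgE => /(can_inj fK)/quot_piE.
exact.
Qed.

Lemma Spec_not_subset (R : comPzRingType) (p q : Spec R) :
  ~ {subset p <= q} -> exists2 a, a \in p & a \notin q.
Proof.
move=> npq; apply: contrapT => E; apply: npq => a ap.
by apply: contraT => aq; case: E; exists a.
Qed.

(** * Filtrations whose factors are quotients by primes *)

Section PrimeFiltration.
Variables (R : comPzRingType) (M : lmodType R) (r : nat).
Variables (F : nat -> submodClosed M) (P : nat -> Spec R).
Hypothesis F0 : F 0%N =i pred1 0.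
Hypothesis Fr : F r =i predT.
Hypothesis FS : forall i, (i < r)%N -> {subset F i <= F i.+1}.
Hypothesis FP : forall i, (i < r)%N ->
  isomorphic (subquotient (F i.+1) (F i)) (quot_mod (spec_submod (P i))).

Lemma filtration_mono i j : (i <= j <= r)%N -> {subset F i <= F j}.
Proof.
move=> /andP[/subnK <-]; elim: (j - i)%N => [|k IHk] kr x xi //.
by apply: (FS kr); apply: IHk => //; exact: ltnW.
Qed.

Lemma filtration_annihil i a x :
  (i < r)%N -> a \in P i -> x \in F i.+1 -> a *: x \in F i.
Proof.
move=> /FP/isomorphic_cyclic[g gF [gP ex]] /gP ag /ex[b xb].
rewrite -(subrK (b *: g) x) scalerDr scalerA mulrC -scalerA.
by rewrite rpredD 1?rpredZ.
Qed.

Lemma filtration_regular i a x : (i < r)%N ->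
  a \notin P i -> x \in F i.+1 -> a *: x \in F i -> x \in F i.
Proof.
move=> /FP/isomorphic_cyclic[g gF [gP ex]] aP /ex[b xb] ax.
rewrite -(subrK (b *: g) x) rpredD//; apply/gP.
have /gP : (a * b) *: g \in F i.
  have -> : (a * b) *: g = a *: x - a *: (x - b *: g).
    by rewrite scalerBr opprB addrC subrK scalerA.
  by apply: submodB; rewrite // rpredZ.
by case/spec_prime => // aP'; rewrite aP' in aP.
Qed.

Lemma filtration_generator i : (i < r)%N ->
  exists2 g, g \in F i.+1 & forall a, a *: g \in F i -> a \in P i.
Proof.
by move=> /FP/isomorphic_cyclic[g gF [gP _]]; exists g => // a /gP.
Qed.

(** The factor has rank one: if [x = a g] and [y = b g] modulo [F i], then [b x = a y] there, and
    [b] avoids [P i] because [y] is nonzero. *)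
Lemma filtration_proportional i x y : (i < r)%N ->
    x \in F i.+1 -> y \in F i.+1 -> y \notin F i ->
  exists a b, b \notin P i /\ b *: x - a *: y \in F i.
Proof.
move=> /FP/isomorphic_cyclic[g gF [gP ex]] /ex[a xa] /ex[b yb] yN.
exists a, b; split.
  apply: contra yN => /gP bg.
  by rewrite -(subrK (b *: g) y) rpredD.
have -> : b *: x - a *: y = b *: (x - a *: g) - a *: (y - b *: g).
  by rewrite !scalerBr !scalerA [a * b]mulrC opprB addrA subrK.
by apply: submodB; exact: rpredZ.
Qed.

Lemma Ass_sub_filtration p : Ass M p -> exists2 i, (i < r)%N & P i = p.
Proof.
move=> [x xp].
(* the nonzero multiples of [x] also have annihilator [p]; take one lying as  *)
(* low as possible in the filtration                                          *)
have annx b a : b \notin p -> (a \in p <-> a *: (b *: x) = 0).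
  move=> bp; rewrite scalerA -xp; split=> [ap|]; last first.
    by case/spec_prime => // bp'; rewrite bp' in bp.
  by rewrite xp mulrC -scalerA (proj1 (xp a)) ?scaler0.
have : exists n, `[< exists2 b, b \notin p & b *: x \in F n >].
  by exists r; apply/asboolP; exists 1; rewrite ?Fr// spec_proper.
move=> /ex_minnP[[|i] /asboolP[b bp bx] imin].
  by move: bx; rewrite F0 inE => /eqP /xp bp'; rewrite bp' in bp.
have ir : (i < r)%N.
  apply: imin; apply/asboolP; exists 1; last by rewrite Fr.
  exact: spec_proper.
have notF c : c \notin p -> c *: x \notin F i.
  move=> cp; apply/negP => cx; have := imin i; rewrite ltnn => H.
  by have //: false by apply: H; apply/asboolP; exists c.
exists i => //; apply: Spec_ext => a; apply/idP/idP => [aP|ap].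
  apply: contraT => ap; have := notF (a * b); rewrite -scalerA => /(_ _)/negP.
  case; last exact: filtration_annihil.
  by apply/negP => /spec_prime[]; apply/negP.
apply: contraT => aP; have /negP[] := notF _ bp.
apply: filtration_regular aP bx _ => //.
by rewrite (proj1 (annx b a bp) ap) rpred0.
Qed.

(** The product of one element of each [P i] outside [p] is a single denominator that kills
    [F n]. *)
Lemma filtration_denom (p : Spec R) n : (n <= r)%N ->
    (forall i, (i < n)%N -> ~ {subset P i <= p}) ->
  exists2 u, u \notin p & forall x, x \in F n -> u *: x = 0.
Proof.
elim: n => [|n IHn] nr Pp.
  exists 1; first exact: spec_proper.
  by move=> x; rewrite F0 inE => /eqP ->; rewrite scaler0.
have [u up u0] := IHn (ltnW nr) (fun i ilt => Pp i (ltnW ilt)).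
have [v vP vp] := Spec_not_subset (Pp n (ltnSn n)).
exists (u * v) => [|x xF].
  by apply/negP => /spec_prime[]; apply/negP.
by rewrite -scalerA u0//; exact: filtration_annihil vP xF.
Qed.

End PrimeFiltration.

(** * Fractions and contraction of submodules of [M_p] *)

Section Fractions.
Variables (R : comPzRingType) (p : Spec R) (M : lmodType R).
Implicit Types (m n : M) (s : loc_denom p).

Definition frac1 m : loc_mod p M := loc_frac m (loc_denom1 p).

Lemma scale_loc_frac a s m t :
  loc_rfrac a s *: loc_frac m t = loc_frac (a *: m) (loc_denomM s t).
Proof. exact: loc_frac_scaleE. Qed.

Lemma loc_frac_scale1 m s : loc_frac m s = loc_rfrac 1 s *: frac1 m.
Proof.
rewrite scale_loc_frac; apply/loc_fracE; exists (loc_denom1 p).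
by rewrite /= mulr1 !scale1r.
Qed.

Lemma frac1D : {morph frac1 : m n / m + n}.
Proof.
move=> m n; rewrite loc_fracD; apply/loc_fracE; exists (loc_denom1 p).
by rewrite /= mulr1 !scale1r.
Qed.

Lemma frac1Z a m : frac1 (a *: m) = loc_rfrac a (loc_denom1 p) *: frac1 m.
Proof.
rewrite scale_loc_frac; apply/loc_fracE; exists (loc_denom1 p).
by rewrite /= mulr1 !scale1r.
Qed.

Lemma frac1_cancel s m : frac1 m = loc_rfrac 1 s *: frac1 ((s : R) *: m).
Proof.
rewrite scale_loc_frac; apply/loc_fracE; exists (loc_denom1 p).
by rewrite /= mulr1 !scale1r.
Qed.

Lemma frac1_scale s m : frac1 m = loc_rfrac s (loc_denom1 p) *: loc_frac m s.
Proof.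
rewrite scale_loc_frac; apply/loc_fracE; exists (loc_denom1 p).
by rewrite /= mul1r !scale1r.
Qed.

Lemma loc_frac0 s : loc_frac (0 : M) s = 0.
Proof.
by apply/loc_fracE; exists (loc_denom1 p); rewrite /= !scaler0.
Qed.

Lemma frac1_eq0 m : frac1 m = 0 -> exists2 u, u \notin p & u *: m = 0.
Proof.
move=> /loc_fracE[[u up] /=]; rewrite !scale1r => um; exists u => //.
by rewrite um !scaler0.
Qed.

(** The power [(w/1)^n] lies in the n-th power of [p R_p]; clearing denominators turns its action on
    [m/1] into an equation in [M]. *)
Lemma frac1_torsion m w :
    frac1 m \in local_cohomology0 (loc_max (p := p)) (loc_mod p M) -> w \in p ->
  exists k u, u \notin p /\ (u * w ^+ k) *: m = 0.
Proof.
move=> /asboolP[n nP] wp; exists n.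
have wn : ideal_pow (loc_max (p := p)) n (loc_rfrac w (loc_denom1 p) ^+ n).
  elim: (n) => [//|k IHk]; exists [:: (loc_rfrac w (loc_denom1 p),
    loc_rfrac w (loc_denom1 p) ^+ k)].
  rewrite big_seq1 exprS; split=> // z; rewrite inE => /eqP -> /=.
  by split=> //; exists w, (loc_denom1 p).
have := nP _ wn.
have -> : loc_rfrac w (loc_denom1 p) ^+ n *: frac1 m = frac1 (w ^+ n *: m).
  elim: (n) => [|k IHk]; first by rewrite !expr0 !scale1r.
  by rewrite !exprS -!scalerA IHk -frac1Z.
by move=> /frac1_eq0[u up u0]; exists u; rewrite -scalerA.
Qed.

Section LocSubmod.
Variable N : submodClosed M.

Definition loc_submod_pred : {pred loc_mod p M} :=
  fun x => `[< exists m s, m \in N /\ x = loc_frac m s >].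

Fact loc_submod_closed : subsemimod_closed loc_submod_pred.
Proof.
split; [split|].
- by apply/asboolP; exists 0, (loc_denom1 p); rewrite rpred0 loc_frac0.
- move=> _ _ /asboolP[m [s [mN ->]]] /asboolP[n [t [nN ->]]]; apply/asboolP.
  exists ((t : R) *: m + (s : R) *: n), (loc_denomM s t).
  by rewrite loc_fracD rpredD ?rpredZ.
- move=> x _ /asboolP[m [s [mN ->]]]; have [a [t ->]] := loc_rfracP x.
  apply/asboolP; exists (a *: m), (loc_denomM t s).
  by rewrite scale_loc_frac rpredZ.
Qed.

HB.instance Definition _ :=
  GRing.isSubmodClosed.Build (loc_ring p) (loc_mod p M) loc_submod_pred
    loc_submod_closed.

Definition loc_submod : submodClosed (loc_mod p M) := loc_submod_pred.

End LocSubmod.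

Section Contraction.
Variable H : submodClosed (loc_mod p M).
Implicit Types L : submodClosed (submod_type H).

(** The preimage of [L] under [M -> M_p]. It moves questions about [H] back to [M], where the
    filtration lives. *)
Definition contraction L m := exists2 h, h \in L & submod_val h = frac1 m.

Lemma contractionZ L a m : contraction L m -> contraction L (a *: m).
Proof.
move=> [h hL hm]; exists (loc_rfrac a (loc_denom1 p) *: h).
  exact: rpredZ.
by rewrite submod_valZ hm frac1Z.
Qed.

Lemma contractionB L m n :
  contraction L m -> contraction L n -> contraction L (m - n).
Proof.
move=> mL /(@contractionZ _ (-1)) [h' hL' hn]; case: mL => h hL hm.
exists (h + h'); first exact: rpredD.
by rewrite submod_valD hm hn -frac1D scaleN1r.
Qed.

Lemma contraction_saturated L u m :
  u \notin p -> contraction L (u *: m) -> contraction L m.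
Proof.
move=> up [h hL hm]; exists (loc_rfrac 1 (LocDenom up) *: h).
  exact: rpredZ.
by rewrite submod_valZ hm [RHS](frac1_cancel (LocDenom up)).
Qed.

Lemma contraction_mem L m : contraction L m -> frac1 m \in H.
Proof. by move=> [[x xH] _ <-]. Qed.

(** A fraction [m/s] differs from [m/1] by a unit, so a submodule is determined by its preimage in
    [M]. *)
Lemma contraction_subset L L' :
  {subset L <= L'} <-> (forall m, contraction L m -> contraction L' m).
Proof.
split=> [LL' m [h /LL' hL hm]|LL' h hL]; first by exists h.
have [m [s hm]] := loc_fracP (submod_val h).
have /LL'[h' hL' h'm] : contraction L m.
  exists (loc_rfrac s (loc_denom1 p) *: h); first exact: rpredZ.
  by rewrite submod_valZ hm -frac1_scale.
suff -> : h = loc_rfrac 1 s *: h' by exact: rpredZ.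
by apply: val_inj; rewrite [LHS]hm [RHS]submod_valZ h'm loc_frac_scale1.
Qed.

End Contraction.
End Fractions.

(** * Upper bound for chains in [H^0_p(M_p)] *)

Section LocalLength.
Variables (R : comPzRingType) (M : lmodType R) (r : nat).
Variables (F : nat -> submodClosed M) (P : nat -> Spec R).
Hypothesis F0 : F 0%N =i pred1 0.
Hypothesis Fr : F r =i predT.
Hypothesis FS : forall i, (i < r)%N -> {subset F i <= F i.+1}.
Hypothesis FP : forall i, (i < r)%N ->
  isomorphic (subquotient (F i.+1) (F i)) (quot_mod (spec_submod (P i))).
Variable p : Spec R.

Let H : submodClosed (loc_mod p M : lmodType (loc_ring p)) :=
  local_cohomology0 (loc_max (p := p)) (loc_mod p M).
Implicit Types L : submodClosed (submod_type H).

(** For [w] in [p] outside [P i], some [u w^n] kills [m]; being outside [P i], it acts injectively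
    on the factor. *)
Lemma torsion_below i m : (i < r)%N -> {subset P i <= p} -> P i <> p ->
  m \in F i.+1 -> frac1 p m \in H -> m \in F i.
Proof.
move=> ir Pip neqp mF mH.
have [w wp wP] : exists2 w, w \in p & w \notin P i.
  apply: Spec_not_subset => pP; apply: neqp; apply: Spec_ext => a.
  by apply/idP/idP => [/Pip|/pP].
have [n [u [up u0]]] := frac1_torsion mH wp.
apply: (filtration_regular FP ir (a := u * w ^+ n)) => //; last first.
  by rewrite u0 rpred0.
apply/negP => /spec_prime[/Pip up'|]; first by rewrite up' in up.
elim: n {u0} => [|n IHn]; first by rewrite expr0 (negPf (spec_proper _)).
by rewrite exprS => /spec_prime[wP'|//]; rewrite wP' in wP.
Qed.

Definition jumps L : {set 'I_r} :=
  [set i : 'I_r | `[< P i = p /\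
     exists m, [/\ contraction L m, m \in F i.+1 & m \notin F i] >]]%SET.

Lemma jumps_subset L L' : {subset L <= L'} -> jumps L \subset jumps L'.
Proof.
move=> /contraction_subset LL'; apply/fintype.subsetP => i; rewrite !inE.
move=> -[Pi [m [mL mF mN]]]; split=> //.
by exists m; split=> //; exact: LL'.
Qed.

(** Induction along the filtration: an element [m] of [F i.+1] is pushed down to [F i], in a way
    that depends on how [P i] compares with [p]. *)
Lemma jumps_subset_inv L L' : {subset L <= L'} ->
  jumps L' \subset jumps L -> {subset L' <= L}.
Proof.
move=> /contraction_subset LL' /fintype.subsetP JL; apply/contraction_subset.
suff key i : (i <= r)%N -> forall m, m \in F i -> contraction L' m -> contraction L m.
  by move=> m; apply: (key r) => //; rewrite Fr.
elim: i => [|i IHi] ir m mF mL'.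
  have -> : m = 0 *: m by move: mF; rewrite F0 inE => /eqP ->; rewrite scaler0.
  exists 0; first exact: rpred0.
  by rewrite scale0r /frac1 loc_frac0.
have [/IHi|mN] := boolP (m \in F i); first by apply=> //; exact: ltnW.
have [Pip|Pip] := pselect (P i = p).
  (* [L] jumps at [i] too, so its contraction has some [n] with [b m = a n] modulo [F i] and [b]
     outside [p]; subtracting [a n] and cancelling [b] reduces to [F i]. *)
  have : Ordinal ir \in jumps L.
    by apply: JL; rewrite !inE; split=> //; exists m.
  rewrite !inE => -[_ [n [nL nF nN]]].
  have [a [b [bP abF]]] := filtration_proportional FP ir mF nF nN.
  rewrite Pip in bP; apply: (contraction_saturated bP).
  have -> : b *: m = (b *: m - a *: n) - (- a) *: n.
    by rewrite scaleNr opprK subrK.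
  apply: contractionB; last exact: contractionZ nL.
  apply: IHi (ltnW ir) _ abF _; apply: contractionB; apply: contractionZ => //.
  exact: LL'.
have [Pisub|] := pselect {subset P i <= p}.
  by case/negP: mN; apply: (torsion_below ir) => //; exact: contraction_mem mL'.
move=> Pnsub.
(* An element of [P i] outside [p] moves [m] into [F i] and is invertible in [R_p]. *)
have [u uP up] := Spec_not_subset Pnsub.
apply: (contraction_saturated up); apply: IHi (ltnW ir) _ _ _.
  exact: (filtration_annihil FP ir uP mF).
exact: contractionZ.
Qed.

Definition prime_multiplicity := count_mem p (mkseq P r).

Lemma card_prime_multiplicity :
  #|[set i : 'I_r | P i == p]%SET| = prime_multiplicity.
Proof.
rewrite /prime_multiplicity count_map -sum1_count -sum1_card.
rewrite -[in RHS](subn0 r) -/(index_iota 0 r) big_mkord.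
by apply: eq_bigl => i; rewrite inE.
Qed.

Lemma chain_bound n C :
  @submod_chain _ (submod_type H) n C -> (n <= prime_multiplicity)%N.
Proof.
(* Each strict inclusion adds at least one jump. *)
move=> Cn; have {Cn}: (n <= #|jumps (C n)|)%N.
  elim: n Cn => [//|n IHn] Cn; have [sub nsub] := Cn n (ltnSn n).
  apply: leq_ltn_trans (IHn (fun i ilt => Cn i (ltnW ilt))) _.
  apply: proper_card; rewrite properE jumps_subset//=.
  by apply/negP => /(jumps_subset_inv sub).
move=> /leq_trans; apply; rewrite -card_prime_multiplicity; apply/subset_leq_card/fintype.subsetP => i.
by rewrite !inE => -[-> _].
Qed.

(** A step down the filtration uses one factor of [p R_p] when [P i = p]; otherwise the fraction is
    rewritten with a numerator one level lower, and one power is given up. *)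
Lemma loc_max_pow_kills n : (n <= r)%N ->
    (forall i, (i < n)%N -> P i = p \/ ~ {subset P i <= p}) ->
  forall x s a, x \in F n -> ideal_pow (loc_max (p := p)) n a ->
    a *: (loc_frac x s : loc_mod p M) = 0.
Proof.
elim: n => [|n IHn] nr Pp x s a.
  by rewrite F0 inE => /eqP -> _; rewrite loc_frac0 scaler0.
move=> xF apow; have {}IHn := IHn (ltnW nr) (fun i ilt => Pp i (ltnW ilt)).
case: (Pp n (ltnSn n)) => [Pn|Pn]; last first.
  have [u uP up] := Spec_not_subset Pn.
  have -> : loc_frac x s = loc_frac (u *: x) (loc_denomM (LocDenom up) s).
    apply/loc_fracE; exists (loc_denom1 p); rewrite /= !scalerA.
    by rewrite -!mulrA [(s : R) * u]mulrC.
  by apply: IHn; [exact: (filtration_annihil FP nr uP xF)|exact: ideal_powS].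
case: apow => t [tP ->]; rewrite scaler_suml big1_seq// => z /andP[_ /tP].
move=> [[b [w [bp ->]]] zpow].
rewrite mulrC -scalerA scale_loc_frac; apply: IHn => //.
by apply: (filtration_annihil FP nr _ xF); rewrite Pn.
Qed.

(** * Pretty cleanness and the exact multiplicity *)

Hypothesis Ppretty : forall i j, (i < j < r)%N -> {subset P i <= P j} -> P i = P j.

Let e := [seq i <- iota 0 r | P i == p].

Let size_e : size e = prime_multiplicity.
Proof. by rewrite size_filter /prime_multiplicity count_map. Qed.

Let e_sorted : sorted ltn e.
Proof. by apply: sorted_filter (iota_ltn_sorted 0 r); exact: ltn_trans. Qed.

Let e_mem j : (j < size e)%N -> (nth r e j < r)%N /\ P (nth r e j) = p.
Proof.
by move=> /(mem_nth r); rewrite mem_filter mem_iota => /andP[/eqP ? ?].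
Qed.

(** The default [r] stands for the index after the last entry of [e], so that the chain built below
    ends in [H] itself. *)
Let e_lt j : (j < size e)%N -> (nth r e j < nth r e j.+1 <= r)%N.
Proof.
move=> je; have [jr _] := e_mem je.
have [je'|je'] := ltnP j.+1 (size e); last by rewrite (nth_default r je') jr leqnn.
rewrite (sorted_ltn_nth ltn_trans r e_sorted)//=.
by case: (e_mem je') => /ltnW.
Qed.

Lemma chain_exists :
  exists C, @submod_chain _ (submod_type H) prime_multiplicity C.
Proof.
(* [H] is cut just below each factor isomorphic to [R / p]; the generator [g] of that factor
   separates consecutive terms. *)
exists (fun j => restrict_submod H (loc_submod p (F (nth r e j)))) => j.
rewrite -size_e => je; have [ir Pi] := e_mem je.
have /andP[ii' i'r] := e_lt je.
set i := nth r e j in ir Pi ii' *; set i' := nth r e j.+1 in ii' i'r *.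
split.
  move=> h /asboolP[m [s [mF hm]]]; apply/asboolP; exists m, s; split=> //.
  by apply: (filtration_mono FS _ mF); rewrite (ltnW ii').
have [g gF gP] := filtration_generator FP ir.
have gH : frac1 p g \in H.
  apply/asboolP; exists i.+1 => a; apply: loc_max_pow_kills gF => // k ki.
  (* By pretty cleanness an earlier prime inside [p = P i] equals [p]. *)
  have [Psub|] := pselect {subset P k <= p}; [left|by right].
  move: ki; rewrite ltnS leq_eqVlt => /orP[/eqP -> //|ki].
  by rewrite -Pi; apply: Ppretty; rewrite ?ki// Pi.
move=> /(_ (SubmodType gH)) sub.
have /sub/asboolP[m [s [mF /= /loc_fracE[u]]]] :
    SubmodType gH \in restrict_submod H (loc_submod p (F i')).
  apply/asboolP; exists g, (loc_denom1 p); split=> //.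
  by apply: (filtration_mono FS _ gF); rewrite ii'.
rewrite /= scale1r scalerA => ug.
have /gP : ((u : R) * (s : R)) *: g \in F i by rewrite ug rpredZ.
by rewrite Pi; apply/negP; exact: loc_denomM_subproof.
Qed.

Lemma mult_prime_multiplicity : mult p M = (prime_multiplicity%:Z)%:E.
Proof.
rewrite /mult /module_length -/H /supremum; set A := (X in X == set0).
have Ak : A (prime_multiplicity%:Z)%:E.
  by exists prime_multiplicity => //; exact: chain_exists.
(* [A] is nonempty, so the default [-oo] is not taken; its maximum is then its unique supremum. *)
rewrite ifF; last by apply/negP => /eqP A0; rewrite A0 in Ak.
apply: xget_subset1; last exact: is_subset1_supremums.
split=> [_ [n [C Cn] <-]|y yA]; last exact: yA.
by rewrite lee_fin lez_nat; exact: chain_bound Cn.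
Qed.

(** At the least [k] with [P k = p], no earlier prime lies in [p], so some [u] outside [p] kills
    [F k]; multiplying a generator of the next factor by [u] gives annihilator exactly [p]. *)
Lemma filtration_prime_Ass i : (i < r)%N -> P i = p -> Ass M p.
Proof.
move=> ir Pi.
have : exists n, (n < r)%N && (P n == p) by exists i; rewrite ir Pi eqxx.
move=> /ex_minnP[k /andP[kr /eqP Pk] kmin].
have [||u up u0] := filtration_denom F0 FP (p := p) (n := k).
- exact: ltnW.
- move=> j jk Pj; have : (k <= j)%N.
    apply: kmin; rewrite (ltn_trans jk kr) -Pk.
    by apply/eqP/Ppretty; rewrite ?jk// Pk.
  by rewrite leqNgt jk.
have [g gF gP] := filtration_generator FP kr.
exists (u *: g) => a; split=> [ap|].
  rewrite scalerA mulrC -scalerA u0//.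
  by apply: (filtration_annihil FP kr _ gF); rewrite Pk.
rewrite scalerA => aug.
have : a * u \in p by rewrite -Pk; apply: gP; rewrite aug rpred0.
by case/spec_prime => // up'; rewrite up' in up.
Qed.

End LocalLength.

(** * Summation over the associated primes *)

(** The list is a permutation of the blocks of copies of its distinct entries. *)
Lemma sum_count_mem_undup (T : eqType) (s : seq T) :
  (\sum_(x <- undup s) count_mem x s)%N = size s.
Proof.
rewrite -(perm_size (perm_count_undup s)) size_flatten /shape sumnE !big_map.
by apply: eq_bigr => x _; rewrite size_nseq.
Qed.

Lemma pretty_clean_length (R : comPzRingType) (M : lmodType R) r
    (F : nat -> submodClosed M) : pretty_clean_filtration r F ->
  finite_set (Ass M) /\ (r%:Z)%:E = (\sum_(p \in Ass M) mult p M)%E.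
Proof.
move=> [F0 Fr FS [P [FP PP]]].
have AssE : Ass M = [set` undup (mkseq P r)].
  apply/seteqP; split=> p /=.
    move=> /(Ass_sub_filtration F0 Fr FP)[i ir <-].
    by rewrite mem_undup map_f// mem_iota.
  rewrite mem_undup => /mapP[i]; rewrite mem_iota => ir ->.
  exact: (filtration_prime_Ass F0 FP PP ir).
split; first by rewrite AssE; exact: finite_seq.
(* The sum now runs over the distinct entries of the list of primes, each contributing its number of
   occurrences, which gives the size [r] of the list. *)
rewrite AssE -fsbig_seq ?undup_uniq//.
under eq_bigr do rewrite (mult_prime_multiplicity F0 Fr FS FP _ PP).
rewrite sumEFin -[in LHS](size_mkseq P r) -sum_count_mem_undup.
by rewrite -natz natr_sum; congr EFin; apply: eq_bigr => p _; rewrite natz.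
Qed.

Unset Implicit Arguments.

Theorem lemma3p9 (R : comPzRingType) (M : lmodType R)
    (noethR : noetherian_ring R) (fgM : finitely_generated M)
    (pcM : pretty_clean M) :
  [/\ (forall r s (F G : nat -> submodClosed M),
         pretty_clean_filtration r F -> pretty_clean_filtration s G -> r = s),
      finite_set (Ass M) &
      forall r (F : nat -> submodClosed M), pretty_clean_filtration r F ->
        (r%:Z)%:E = (\sum_(p \in Ass M) mult p M)%E].
Proof.
split=> [r s F G /pretty_clean_length[_ rE] /pretty_clean_length[_]||].
- by rewrite -rE => -[].
- by have [r [F /pretty_clean_length[]]] := pcM.
- by move=> r F /pretty_clean_length[].
Qed.
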